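(* Let $ABC$ be a (non-degenerate) triangle in the Euclidean plane. Let $D$ and $K$ be points on side $BC$, $E$ and $L$ points on side $AC$, and $F$ and $M$ points on side $AB$, all different from the vertices $A,B,C$. Denote $AK\cap EF=N$, $BL\cap DF=Q$, $CM\cap DE=P$. If $$\frac{|BD|}{|DC|}\cdot\frac{|CE|}{|EA|}\cdot\frac{|AF|}{|FB|}\cdot\frac{|BK|}{|KC|}\cdot\frac{|CL|}{|LA|}\cdot\frac{|AM|}{|MB|}=1,$$ then the lines $DN$, $EQ$, and $FP$ are concurrent.
   Context: $XY\cap ZW$ denotes the intersection point of the lines $XY$ and $ZW$, and $|XY|$ the length of segment $XY$. Three lines are concurrent if they pass through a common point. *)

(* Defs.v *)
From mathcomp Require Import all_boot all_order all_algebra.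
From mathcomp Require Import boolp classical_sets reals.

Set Implicit Arguments.
Unset Strict Implicit.
Unset Printing Implicit Defensive.

Import Order.TTheory GRing.Theory Num.Theory.

Local Open Scope classical_set_scope.
Local Open Scope ring_scope.

Notation plane R := 'rV[R]_2.

(* The norm that MathComp-Analysis puts on 'rV is the sup norm, hence this
   explicit Euclidean distance. *)
Definition dist (R : realType) (X Y : plane R) : R :=
  Num.sqrt (\sum_(i < 2) (X 0 i - Y 0 i) ^+ 2).

(* This is a line only when X != Y; line X X is the singleton [set X]. *)
Definition line (R : realType) (X Y : plane R) : set (plane R) :=
  [set Z | exists t : R, Z = (1 - t) *: X + t *: Y].

Definition segment (R : realType) (X Y : plane R) : set (plane R) :=
  [set Z | exists t : R, 0 <= t <= 1 /\ Z = (1 - t) *: X + t *: Y].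

Definition collinear (R : realType) (A B C : plane R) : Prop :=
  exists X Y : plane R, [/\ X != Y, line X Y A, line X Y B & line X Y C].

Definition concurrent (R : realType) (l1 l2 l3 : set (plane R)) : Prop :=
  exists X : plane R, [/\ l1 X, l2 X & l3 X].

Definition on_side (R : realType) (X Y Z : plane R) : Prop :=
  [/\ segment X Y Z, Z != X & Z != Y].

(* Main.v *)
(** If BK : KC = k : k', CE : EA = e : e' and AF : FB = f : f', then comparing
    the B- and C-coordinates shows that AK cuts EF at the mean of E and F with
    weights fk and e'k'; cyclically for Q on FD and P on DE. The hypothesis says
    exactly that the product of these three ratios is 1, so they come from one
    system of positive masses at D, E, F, whose center of mass is on DN, EQ and
    FP: this is the converse of Ceva's theorem in the triangle DEF. *)
Require Import Defs.
From mathcomp Require Import all_boot all_order all_algebra.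
From mathcomp Require Import boolp classical_sets reals.
From mathcomp Require Import ring lra.

Set Implicit Arguments.
Unset Strict Implicit.

Import Order.TTheory GRing.Theory Num.Theory.

Local Open Scope classical_set_scope.
Local Open Scope ring_scope.

(** The center of mass of [a] at [X] and [b] at [Y]. Only the ratio of [a] to [b] matters, so
    products of side weights can serve as masses without normalization. *)
Definition wmean (R : realType) (a b : R) (X Y : plane R) : plane R :=
  (a / (a + b)) *: X + (b / (a + b)) *: Y.

Lemma line_wmean (R : realType) (a b : R) (X Y : plane R) :
  a + b != 0 -> line X Y (wmean a b X Y).
Proof.
move=> ab0; exists (b / (a + b)); congr (_ *: _ + _).
by field.
Qed.

Lemma lineC (R : realType) (X Y : plane R) : line X Y = line Y X.
Proof.
have sub (U V : plane R) : line U V `<=` line V U.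
  by move=> Z [t ->]; exists (1 - t); rewrite addrC subKr.
by apply/seteqP; split; exact: sub.
Qed.

Lemma distC (R : realType) (X Y : plane R) : dist X Y = dist Y X.
Proof.
by rewrite /dist; congr Num.sqrt; apply: eq_bigr => i _; rewrite -sqrrN opprB.
Qed.

Lemma dist_affine (R : realType) (X Y : plane R) (t : R) :
  0 <= t -> dist X ((1 - t) *: X + t *: Y) = t * dist X Y.
Proof.
move=> t0; rewrite -[t in RHS](ger0_norm t0) -sqrtr_sqr /dist -sqrtrM ?sqr_ge0//.
congr Num.sqrt; rewrite big_distrr; apply: eq_bigr => i _ /=.
by rewrite !mxE; ring.
Qed.

Lemma dist_neq0 (R : realType) (X Y : plane R) : X != Y -> dist X Y != 0.
Proof.
apply: contra_neq => /eqP; rewrite sqrtr_eq0 => le0.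
have /eqP : \sum_(i < 2) (X 0 i - Y 0 i) ^+ 2 = 0.
  by apply/eqP; rewrite eq_le le0 sumr_ge0// => i _; exact: sqr_ge0.
rewrite psumr_eq0 => [/allP sum0|i _]; last exact: sqr_ge0.
apply/rowP => i; apply/eqP; rewrite -subr_eq0 -sqrf_eq0.
exact: sum0 i (mem_index_enum i).
Qed.

Lemma on_sideC (R : realType) (X Y Z : plane R) :
  on_side X Y Z -> on_side Y X Z.
Proof.
move=> [[t [t01 ->]] ZX ZY]; split=> //; exists (1 - t); split; first by lra.
by rewrite addrC subKr.
Qed.

(** Turns a ratio of lengths into a ratio of barycentric coordinates. The weights cross over: [u],
    which measures the part next to [X], is the coefficient of [Y]. *)
Lemma on_side_wmean (R : realType) (X Y Z : plane R) : on_side X Y Z ->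
  exists u v : R, [/\ 0 < u, 0 < v, u + v = 1, Z = v *: X + u *: Y
    & dist X Z / dist Z Y = u / v].
Proof.
move=> [[t [/andP[t0 t1] defZ]] ZX ZY].
have t_gt0 : 0 < t.
  rewrite lt_def t0 andbT; apply: contra_neq ZX => t_eq0.
  by rewrite defZ t_eq0 subr0 scale1r scale0r addr0.
have t_lt1 : t < 1.
  rewrite lt_def t1 andbT; apply: contra_neq ZY => t_eq1.
  by rewrite defZ -t_eq1 subrr scale1r scale0r add0r.
(* If the ends coincided, the segment would shrink to [X], which [Z] avoids; hence [dist X Y] can be
   cancelled from the ratio. *)
have XY : X != Y.
  by apply: contra_neq ZX => eqXY; rewrite defZ -eqXY -scalerDl subrK scale1r.
exists t, (1 - t); split=> //; [by rewrite subr_gt0|by rewrite addrC subrK|].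
have -> : dist X Z = t * dist X Y by rewrite defZ dist_affine.
have -> : dist Z Y = (1 - t) * dist X Y.
  rewrite distC defZ (distC X Y).
  have -> : (1 - t) *: X + t *: Y = (1 - (1 - t)) *: Y + (1 - t) *: X.
    by rewrite addrC subKr.
  by rewrite dist_affine ?subr_ge0.
by rewrite -mulf_div divff ?mulr1// dist_neq0.
Qed.

Lemma cevian_transversal (R : realType) (A B C E F K : plane R)
    (k k' e e' f f' : R) :
  0 < k -> 0 < k' -> 0 < e' -> 0 < f ->
  k + k' = 1 -> e + e' = 1 -> f + f' = 1 ->
  K = k' *: B + k *: C -> E = e' *: C + e *: A -> F = f' *: A + f *: B ->
  (line A K `&` line E F) (wmean (f * k) (e' * k') E F).
Proof.
move=> k0 k'0 e'0 f0 kk ee ff defK defE defF.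
have s0 : 0 < f * k + e' * k' by rewrite addr_gt0 ?mulr_gt0.
split; last by apply: line_wmean; rewrite gt_eqF.
(* The parameter on [AK] is the total weight of [B] and [C] in the mean: [e' * k' * f + f * k * e'],
   which is [e' * f] as [k + k' = 1], over the total mass. *)
exists (e' * f / (f * k + e' * k')).
have [k1 e1 f1] : [/\ k' = 1 - k, e = 1 - e' & f' = 1 - f] by split; lra.
rewrite /wmean defK defE defF; apply/rowP => i; rewrite !mxE.
move: s0; rewrite k1 e1 f1 => /lt0r_neq0 s0.
by field.
Qed.

(** As [y : z = p : q], the masses at [E] and [F] can be merged into [y + z] at [wmean p q E F];
    what remains is a mean of [D] and that point. *)
Lemma line_barycenter (R : realType) (D E F : plane R) (p q x y z : R) :
  0 < p -> 0 < q -> 0 < x -> 0 < y -> 0 < z -> p * z = q * y ->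
  line D (wmean p q E F)
    ((x + y + z)^-1 *: (x *: D + y *: E + z *: F)).
Proof.
move=> p0 q0 x0 y0 z0 pz; exists ((y + z) / (x + y + z)).
have zE : z = q * y / p by rewrite -pz mulrC mulKf ?gt_eqF.
apply/rowP => i; rewrite !mxE zE.
by field; rewrite !gt_eqF ?addr_gt0 ?mulr_gt0 ?addr_gt0.
Qed.

Lemma ceva_converse (R : realType) (D E F : plane R) (p q r p' q' r' : R) :
  0 < p -> 0 < q -> 0 < r -> 0 < p' -> 0 < q' -> 0 < r' ->
  p * q * r = p' * q' * r' ->
  concurrent (line D (wmean p p' E F)) (line E (wmean q q' F D))
    (line F (wmean r r' D E)).
Proof.
move=> p0 q0 r0 p'0 q'0 r'0 pqr.
(* Chosen so that [y : z = p : p'] and [z : x = q : q']; then [x : y = r : r'] is the hypothesis on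
   the products. *)
pose x := p' * q'; pose y := p * q; pose z := p' * q.
have [x0 y0 z0] : [/\ 0 < x, 0 < y & 0 < z] by rewrite !mulr_gt0.
exists ((x + y + z)^-1 *: (x *: D + y *: E + z *: F)); split.
- by apply: line_barycenter => //; rewrite /y /z; ring.
(* Both sums are rotated so that the mass at [E] comes first, as [line_barycenter] expects. *)
- rewrite -(addrA x) (addrC x) -(addrA (x *: D)) (addrC (x *: D)).
  by apply: line_barycenter => //; rewrite /x /z; ring.
- rewrite (addrC _ z) addrA (addrC _ (z *: F)) addrA.
  by apply: line_barycenter => //; rewrite /x /y mulrC pqr; ring.
Qed.

Theorem corollary2p2 (R : realType) (A B C D E F K L M N P Q : plane R)
  (ABC : ~ collinear A B C)
  (D_BC : on_side B C D) (K_BC : on_side B C K)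
  (E_AC : on_side A C E) (L_AC : on_side A C L)
  (F_AB : on_side A B F) (M_AB : on_side A B M)
  (defN : line A K `&` line E F = [set N])
  (defQ : line B L `&` line D F = [set Q])
  (defP : line C M `&` line D E = [set P])
  (ratios : dist B D / dist D C * (dist C E / dist E A) *
            (dist A F / dist F B) * (dist B K / dist K C) *
            (dist C L / dist L A) * (dist A M / dist M B) = 1) :
  concurrent (line D N) (line E Q) (line F P).
Proof.
have [d [d' [d0 d'0 dd defD rD]]] := on_side_wmean D_BC.
have [k [k' [k0 k'0 kk defK rK]]] := on_side_wmean K_BC.
(* The ratios run around the triangle from [B] to [C] to [A], so side [AC] is read from [C]. *)
have [e [e' [e0 e'0 ee defE rE]]] := on_side_wmean (on_sideC E_AC).
have [l [l' [l0 l'0 ll defL rL]]] := on_side_wmean (on_sideC L_AC).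
have [f [f' [f0 f'0 ff defF rF]]] := on_side_wmean F_AB.
have [m [m' [m0 m'0 mm defM rM]]] := on_side_wmean M_AB.
rewrite {}rD {}rK {}rE {}rL {}rF {}rM in ratios.
(* Membership in the singleton [[set N]] is an equation, which replaces [N] by its weighted mean;
   likewise for [Q] and [P] after cyclic shifts. *)
have := @cevian_transversal R A B C E F K k k' e e' f f'.
rewrite defN => /= <- //.
have := @cevian_transversal R B C A F D L l l' f f' d d'.
rewrite (lineC F) defQ => /= <- //.
have := @cevian_transversal R C A B D E M m m' d d' e e'.
rewrite defP => /= <- //.
apply: ceva_converse; rewrite ?mulr_gt0//.
have nz : d' * e' * f' * k' * l' * m' != 0 by rewrite gt_eqF ?mulr_gt0.
(* The middle term is the product in [ratios] times all its denominators. *)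
transitivity (d / d' * (e / e') * (f / f') * (k / k') * (l / l') * (m / m') *
  (d' * e' * f' * k' * l' * m')); last by rewrite ratios; ring.
by field; rewrite !gt_eqF.
Qed.
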